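(* The function $\mathcal{I}\colon[0,1]\cap\mathbb{Q}\to\mathbb{R}$ extends uniquely to a continuous, strictly increasing function $\mathcal{I}\colon[0,1]\to\mathbb{R}$. Moreover, for all real $x\in[0,1]$ the extension satisfies $\mathcal{I}(0)=0$, $\mathcal{I}(x)=4^{-\lfloor1/x\rfloor}\big(1-2\,\mathcal{I}(\{1/x\})\big)$ if $0<x\le\tfrac12$, and $\mathcal{I}(x)=\tfrac38-\tfrac34\,\mathcal{I}(1/x-1)-\tfrac12\,\mathcal{I}(1-x)$ if $\tfrac12<x\le1$.
   Context: For $x\in\mathbb{R}$ let $\{x\}=x-\lfloor x\rfloor$. The interrobang function $\mathcal{I}\colon[0,1]\cap\mathbb{Q}\to\mathbb{R}$ is defined recursively by $\mathcal{I}(0)=0$; $\mathcal{I}(x)=4^{-\lfloor1/x\rfloor}\big(1-2\,\mathcal{I}(\{1/x\})\big)$ if $0<x\le\tfrac12$; and $\mathcal{I}(x)=\tfrac38-\tfrac34\,\mathcal{I}(1/x-1)-\tfrac12\,\mathcal{I}(1-x)$ if $\tfrac12<x\le1$. The recursion is well founded: with the height $a/b\mapsto|a|+|b|$ ($\gcd(a,b)=1$), every argument on the right-hand side has strictly smaller height than $x$, so $\mathcal{I}$ is uniquely defined. *)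

(* Defs.v *)
From HB Require Import structures.
From mathcomp Require Import all_boot all_order all_algebra.
From mathcomp Require Import all_classical all_reals all_analysis.
Set Implicit Arguments. Unset Strict Implicit. Unset Printing Implicit Defensive.
Import Order.TTheory GRing.Theory Num.Theory.
Local Open Scope ring_scope.

Definition fracpart {R : archiDomainType} (x : R) : R := x - (Num.floor x)%:~R.

Definition qheight (x : rat) : nat := (`|numq x| + `|denq x|)%N.

(* Fuel-driven unfolding of the interrobang recursion on rationals.
   Every recursive argument has strictly smaller height, so fuel = height
   suffices (the value is independent of any fuel >= height). *)
Fixpoint Iq_fuel (n : nat) (x : rat) : rat :=
  match n with
  | O => 0
  | S n' =>
      if x == 0 then 0
      else if x <= 1 / 2 then
        (4 : rat) ^ (- Num.floor x^-1) * (1 - 2 * Iq_fuel n' (fracpart x^-1))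
      else 3 / 8 - 3 / 4 * Iq_fuel n' (x^-1 - 1) - 1 / 2 * Iq_fuel n' (1 - x)
  end.

(* The interrobang function on [0,1] ∩ Q (values outside [0,1] are irrelevant). *)
Definition interrobangQ (x : rat) : rat := Iq_fuel (qheight x) x.

(* Main.v *)
Require Import Defs.
From HB Require Import structures.
From mathcomp Require Import all_boot all_order all_algebra.
From mathcomp Require Import all_classical all_reals all_analysis.
From mathcomp Require Import ring lra zify.
Import Order.TTheory GRing.Theory Num.Theory.
Import numFieldNormedType.Exports.
Local Open Scope classical_set_scope.
Local Open Scope ring_scope.

Set Implicit Arguments.
Unset Strict Implicit.
Unset Printing Implicit Defensive.

(** The right-hand side of the recursion is an operator on functions on [0, 1].
    It contracts, by the factor 11/12, the supremum norm that gives weight 3 to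
    [0, 1/2], and it preserves the continuous nondecreasing functions with
    values 0, 1/16 and 3/8 at 0, 1/2 and 1: with these values the formulas on
    the closed pieces [1/(n+1), 1/n] agree at the common endpoints. Its iterates
    therefore converge uniformly to a continuous nondecreasing fixed point F,
    which agrees with the recursion at every rational by induction on the
    height. Uniqueness is the density of the rationals.

    On each piece, an increment of F is at least a positive multiple of the
    increment of F between the points 1/x - n. If F were constant on a
    nontrivial interval [u, v] then, for each x in [u, v], it would also be
    constant on a nontrivial interval containing some 1/x - n. Starting from a
    rational x, the Euclidean algorithm leads to x = 0, and F > 0 on (0, 1]. *)

(** * Closed pieces *)

Definition recip_itv {K : realFieldType} (n : nat) : interval K :=
  `[n.+1%:R^-1, n%:R^-1].

Section RecipItv.
Variable K : realFieldType.
Implicit Types (x : K) (n : nat).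

Lemma recip_itv_gt0 n x : x \in recip_itv n -> 0 < x.
Proof.
by rewrite in_itv => /andP[+ _]; apply: lt_le_trans; rewrite invr_gt0.
Qed.

Lemma recip_itv_le1 n x : (0 < n)%N -> x \in recip_itv n -> x <= 1.
Proof.
move=> n0; rewrite in_itv => /andP[_] /le_trans; apply.
by rewrite invf_le1 ?ltr0n // ler1n.
Qed.

Lemma recip_itv_itv01 n x : (0 < n)%N -> x \in recip_itv n -> x \in `[0, 1].
Proof.
move=> n0 xn.
by rewrite in_itv /= (recip_itv_le1 n0 xn) ltW ?(recip_itv_gt0 xn).
Qed.

Lemma recip_itv_invB n x : (0 < n)%N -> x \in recip_itv n ->
  x^-1 - n%:R \in `[0, 1].
Proof.
move=> n0 xn; have x0 := recip_itv_gt0 xn.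
move: xn; rewrite !in_itv /= subr_ge0 lerBlDl natr1 => /andP[nx xn].
by rewrite invf_ple ?posrE // invf_pge ?posrE ?ltr0n // xn.
Qed.

Lemma recip_itv_invB_le n : {in recip_itv n &, forall x y,
  (x^-1 - n%:R <= y^-1 - n%:R) = (y <= x)}.
Proof.
move=> x y /recip_itv_gt0 x0 /recip_itv_gt0 y0.
by rewrite lerD2r lef_pV2 ?posrE.
Qed.

Lemma recip_itv_invB_lt n : {in recip_itv n &, forall x y,
  (x^-1 - n%:R < y^-1 - n%:R) = (y < x)}.
Proof. by move=> x y xn yn; rewrite !ltNge recip_itv_invB_le. Qed.

Lemma recip_itv_le_half n x : (1 < n)%N -> x \in recip_itv n -> x <= 1 / 2.
Proof.
move=> n1; rewrite in_itv => /andP[_] /le_trans; apply.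
by rewrite div1r lef_pV2 ?posrE ?ltr0n ?ler_nat // ltnW.
Qed.

End RecipItv.

Lemma ex_natSinv_lt {K : archiRealFieldType} (x : K) : 0 < x ->
  exists n : nat, n.+1%:R^-1 < x.
Proof.
by exists (Num.truncn x^-1); rewrite invf_plt ?posrE ?ltr0n // truncnS_gt.
Qed.

Lemma ex_recip_itvoc {K : archiRealFieldType} (x : K) : 0 < x <= 1 ->
  exists2 n, (0 < n)%N & x \in `]n.+1%:R^-1, n%:R^-1].
Proof.
move=> /andP[x0 x1]; have x1' : 1 <= x^-1 by rewrite invf_ge1.
have n0 : (0 < Num.truncn x^-1)%N by rewrite truncn_gt0.
exists (Num.truncn x^-1) => //.
have /andP[nx xn] := truncn_itv (ltW (lt_le_trans ltr01 x1')).
by rewrite in_itv /= invf_plt ?posrE // xn invf_pge ?posrE ?ltr0n.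
Qed.

Lemma ex_recip_itvoc_small {K : archiRealFieldType} (x : K) : 0 < x <= 1 / 2 ->
  exists2 n, (1 < n)%N & x \in `]n.+1%:R^-1, n%:R^-1].
Proof.
move=> /andP[x0 xh]; have [|n n0 xn] := @ex_recip_itvoc K x; first by lra.
exists n => //; rewrite ltn_neqAle n0 andbT; apply/eqP => n1.
by move: xn; rewrite -n1 in_itv /=; lra.
Qed.

Lemma ex_recip_itvco {K : archiRealFieldType} (x : K) : 0 < x < 1 ->
  exists2 n, (0 < n)%N & x \in `[n.+1%:R^-1, n%:R^-1[.
Proof.
move=> /andP[x0 x1].
have [|n n0] := @ex_recip_itvoc K x; first by rewrite x0 ltW.
rewrite in_itv /= => /andP[nx]; rewrite le_eqVlt => /predU1P[xn|xn]; last first.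
  by exists n; rewrite // in_itv /= xn ltW.
case: n n0 {nx} xn x1 => // -[|n] _ ->; first by rewrite invr1 ltxx.
exists n.+1 => //; rewrite in_itv /= lexx ltf_pV2 ?posrE ?ltr0n //.
by rewrite /= ltr_nat.
Qed.

Lemma ex_recip_itv_subitv {K : archiRealFieldType} (u x v : K) :
  0 < x -> u <= x -> x <= v -> v <= 1 -> u < v ->
  exists n u' v', [/\ (0 < n)%N,
    [/\ u' \in recip_itv n, x \in recip_itv n & v' \in recip_itv n],
    u <= u' <= x, x <= v' <= v & u' < v'].
Proof.
move=> x0 ux xv v1 uv.
suff [n n0] : exists2 n, (0 < n)%N & n.+1%:R^-1 <= x <= n%:R^-1 /\
    Num.max u n.+1%:R^-1 < Num.min v n%:R^-1.
  move=> [/andP[nx xn] uv'].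
  exists n, (Num.max u n.+1%:R^-1), (Num.min v n%:R^-1); split => //.
  - split; rewrite in_itv /= ?nx ?xn //.
      by rewrite le_max lexx orbT ge_max (le_trans ux xn) (le_trans nx xn).
    by rewrite ge_min lexx orbT le_min (le_trans nx xv) (le_trans nx xn).
  - by rewrite le_max lexx ge_max ux nx.
  - by rewrite ge_min lexx le_min xv xn.
have nS n : (0 < n)%N -> n.+1%:R^-1 < n%:R^-1 :> K.
  by move=> n0; rewrite ltf_pV2 ?posrE ?ltr0n // ltr_nat.
(* The piece is taken on a side of x on which [u, v] is nontrivial. *)
have [ux'|xu] := ltP u x.
- have [|n n0] := @ex_recip_itvoc K x; first by rewrite x0 (le_trans xv).
  rewrite in_itv /= => /andP[nx xn]; exists n => //; rewrite ltW // xn.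
  by rewrite gt_max !lt_min uv nS // (lt_le_trans ux') // (lt_le_trans nx).
- have xv' : x < v := le_lt_trans xu uv.
  have [|n n0] := @ex_recip_itvco K x; first by rewrite x0 (lt_le_trans xv').
  rewrite in_itv /= => /andP[nx xn]; exists n => //; rewrite nx ltW //.
  by rewrite gt_max !lt_min uv nS // (le_lt_trans nx) // (le_lt_trans ux).
Qed.

(** * The recursion operator *)

Lemma fracpart_itv {K : archiRealDomainType} (x : K) : fracpart x \in `[0, 1[.
Proof.
have /andP[x0 x1] := floor_itv x.
by rewrite in_itv /= subr_ge0 x0 ltrBlDl -intrD1.
Qed.

Definition interrobang_step {K : archiRealFieldType} (f : K -> K) (x : K) : K :=
  if x == 0 then 0
  else if x <= 1 / 2 then
    4 ^ (- Num.floor x^-1) * (1 - 2 * f (fracpart x^-1))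
  else 3 / 8 - 3 / 4 * f (x^-1 - 1) - 1 / 2 * f (1 - x).

Section InterrobangStep.
Variable K : archiRealFieldType.
Implicit Types (f : K -> K) (x : K) (n : nat).

Lemma interrobang_step0 f : interrobang_step f 0 = 0.
Proof. by rewrite /interrobang_step eqxx. Qed.

Lemma interrobang_step_small f n x : (1 < n)%N ->
  x \in `]n.+1%:R^-1, n%:R^-1] ->
  interrobang_step f x = 4 ^- n * (1 - 2 * f (x^-1 - n%:R)).
Proof.
move=> n1 xn; have xI : x \in recip_itv n by exact: subset_itv_oc_cc.
have x0 := recip_itv_gt0 xI; have n0 := ltnW n1.
have floorE : Num.floor x^-1 = n.
  apply: floor_def; move: xn; rewrite in_itv /= => /andP[nx xn].
  rewrite intrD mulr1z -pmulrn natr1.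
  by rewrite invf_pge ?posrE ?ltr0n // invf_plt ?posrE ?xn.
rewrite /interrobang_step gt_eqF // (recip_itv_le_half n1 xI) /fracpart floorE.
by rewrite -pmulrn -exprnN.
Qed.

Lemma interrobang_step_large f x : 1 / 2 < x ->
  interrobang_step f x = 3 / 8 - 3 / 4 * f (x^-1 - 1) - 1 / 2 * f (1 - x).
Proof.
move=> xh; rewrite /interrobang_step gt_eqF; last by lra.
by rewrite leNgt xh.
Qed.

End InterrobangStep.

(** * Monotone continuous functions on an interval *)

Lemma continuous_comp_within {T U V : topologicalType} (A : set T) (B : set U)
    (g : T -> U) (f : U -> V) : {homo g : x / A x >-> B x} ->
  {within A, continuous g} -> {within B, continuous f} ->
  {within A, continuous (f \o g)}.
Proof.
move=> gAB /subspace_continuousP cg /subspace_continuousP cf.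
apply/subspace_continuousP => x Ax; apply: cvg_comp (cf _ (gAB _ Ax)).
move=> W /(cg x Ax); rewrite /= !nbhs_simpl /within /=.
by apply: filterS => y h Ay; apply: h => //; exact: gAB.
Qed.

Lemma eq_continuous_rat {R : realType} {V : normedModType R} (a b : R)
    (f g : R -> V) : a < b ->
  {within `[a, b], continuous f} -> {within `[a, b], continuous g} ->
  (forall q : rat, ratr q \in `[a, b] -> f (ratr q) = g (ratr q)) ->
  {in `[a, b], f =1 g}.
Proof.
move=> ab cf cg fg x xab; apply: contrapT => /eqP; rewrite -subr_eq0 => fgx.
have /subspace_continuousP/(_ x xab) := within_continuousB cf cg.
move/cvgrPdist_lt => /(_ `|f x - g x|); rewrite normr_gt0 fgx => /(_ isT).
rewrite near_withinE => /nbhs_ballP[d /= d0 hd].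
move: (xab); rewrite in_itv /= => /andP[ax xb].
have [|q] := @rat_in_itvoo R (Num.max a (x - d)) (Num.min b (x + d)).
  by rewrite gt_max !lt_min; apply/andP; split; apply/andP; split; lra.
rewrite in_itv /= gt_max lt_min => /andP[/andP[aq dq] /andP[qb qd]].
have qab : ratr q \in `[a, b] by rewrite in_itv /= !ltW.
suff : `|(f x - g x) - (f (ratr q) - g (ratr q))| < `|f x - g x|.
  by rewrite fg // subrr subr0 ltxx.
by apply: hd => //; rewrite /ball /= ltr_distlC; apply/andP; split; lra.
Qed.

Lemma within_continuous_recip_itv {R : realType} {V : topologicalType} (n : nat)
    (f : R -> V) : (0 < n)%N -> {within `[0, 1], continuous f} ->
  {within [set` recip_itv n], continuous (fun x => f (x^-1 - n%:R))}.
Proof.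
move=> n0; apply: (@continuous_comp_within R R V _ `[0, 1]%classic
  (fun x => x^-1 - n%:R)) => [x|]; first exact: recip_itv_invB.
apply: continuous_in_subspaceT => x /set_mem /= xn.
apply: cvgB; last exact: cvg_cst.
by apply: cvgV; rewrite ?gt_eqF ?(recip_itv_gt0 xn).
Qed.

Lemma within_continuous_onem {R : realType} {V : topologicalType} (f : R -> V) :
  {within `[0, 1], continuous f} ->
  {within `[0, 1], continuous (fun x => f (1 - x))}.
Proof.
apply: (@continuous_comp_within R R V _ `[0, 1]%classic (fun x => 1 - x)).
  by move=> x; rewrite /= !in_itv /=; lra.
apply: continuous_subspaceT => x.
by apply: cvgB; [exact: cvg_cst|exact: cvg_id].
Qed.

Definition nondecreasing_continuous {R : realType} (I : interval R)
    (f : R -> R) : Prop :=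
  {within [set` I], continuous f} /\ {in I &, {homo f : x y / x <= y}}.

Section NondecreasingContinuous.
Variable R : realType.
Implicit Types (f : R -> R) (a b c : R).

Lemma nondecreasing_continuousS f (I J : interval R) : {subset I <= J} ->
  nondecreasing_continuous J f -> nondecreasing_continuous I f.
Proof.
move=> IJ [cf hf]; split; first exact: continuous_subspaceW cf.
by move=> x y /IJ xJ /IJ yJ; exact: hf.
Qed.

Lemma nondecreasing_continuous_cat f a b c : a <= b <= c ->
  nondecreasing_continuous `[a, b] f -> nondecreasing_continuous `[b, c] f ->
  nondecreasing_continuous `[a, c] f.
Proof.
move=> abc [cab hab] [cbc hbc]; have /andP[ab bc] := abc; split.
  apply: (@continuous_subspaceW _ _ _ (`[a, b] `|` `[b, c])%classic).
    move=> x; rewrite /= !in_itv /= => /andP[-> ->].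
    by rewrite !andbT; case: (leP x b) => [|/ltW]; [left|right].
  by apply: withinU_continuous => //; exact: itv_closed.
move=> x y; rewrite !in_itv /= => /andP[ax xc] /andP[ay yc] xy.
have [yb|lt_by] := leP y b.
  by apply: hab => //; rewrite in_itv /= ?ax ?ay // (le_trans xy).
have [xb|bx] := leP x b; last first.
  by apply: hbc => //; rewrite in_itv /= ?yc ?xc ltW.
apply: (@le_trans _ _ (f b)).
  by apply: hab => //; rewrite in_itv /= ?ax ?ab ?lexx.
by apply: hbc; rewrite ?in_itv /= ?lexx ?bc ?yc ?andbT ?ltW.
Qed.

Lemma nondecreasing_itv01 f :
  (forall n : nat, {in `[n.+1%:R^-1, 1] &, {homo f : x y / x <= y}}) ->
  f n.+1%:R^-1 @[n --> \oo] --> f 0 ->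
  {in `[0, 1] &, {homo f : x y / x <= y}}.
Proof.
move=> homof f0.
have leSinv (n : nat) (x : R) : n.+1%:R^-1 < x -> x <= 1 ->
    x \in `[n.+1%:R^-1, 1].
  by move=> nx x1; rewrite in_itv /= ltW.
have f0_le x : 0 <= x <= 1 -> f 0 <= f x.
  move=> /andP[]; rewrite le_eqVlt => /predU1P[<-//|x0 x1].
  apply: cvgr_to_le f0 _; near=> n.
  have nx : n.+1%:R^-1 < x.
    by near: n; exact: (near_infty_natSinv_lt (PosNum x0)).
  apply: (homof n); [|exact: leSinv|exact: ltW].
  by rewrite in_itv /= lexx invf_le1 ?ltr0n // ler1n.
move=> x y; rewrite !in_itv /= => /andP[+ x1] y01 xy.
rewrite le_eqVlt => /predU1P[<-|/ex_natSinv_lt[n nx]]; first exact: f0_le.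
apply: (homof n) => //; apply: leSinv => //; last by case/andP: y01.
exact: lt_le_trans nx xy.
Unshelve. all: by end_near.
Qed.

Lemma within_continuous_itv01 f :
  (forall n : nat, {within `[n.+1%:R^-1, 1], continuous f}) ->
  {in `[0, 1] &, {homo f : x y / x <= y}} ->
  f n.+1%:R^-1 @[n --> \oo] --> f 0 -> {within `[0, 1], continuous f}.
Proof.
move=> cf homof f0; apply/subspace_continuousP => x /=.
rewrite in_itv /= => /andP[+ x1].
rewrite le_eqVlt => /predU1P[<-|x0]; last first.
  have [n nx] := ex_natSinv_lt x0.
  have /subspace_continuousP/(_ x) := cf n.
  rewrite /= in_itv /= (ltW nx) x1 => /(_ isT); apply: cvg_trans => W.
  rewrite /= !nbhs_simpl /within /=; apply: filterS2 (lt_nbhsr nx) => y ny Wy.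
  by rewrite in_itv /= => /andP[_ y1]; apply: Wy; rewrite in_itv /= ltW.
apply/cvgrPdist_le => e e0; rewrite near_withinE.
move/cvgrPdist_le : f0 => /(_ e e0)[n _ /(_ n (leqnn n)) /= fn].
near=> y => y01; have f0y : f 0 <= f y.
  have /andP[y0 _] : 0 <= y <= 1 := y01.
  by apply: homof; rewrite ?bound_itvE.
rewrite distrC ger0_norm ?subr_ge0 //.
apply: le_trans fn; rewrite distrC; apply: le_trans (ler_norm _).
rewrite lerB // homof ?in_itv //= ?invr_ge0 ?ler0n ?invf_le1 ?ltr0n ?ler1n //.
by apply: ltW; near: y; apply: lt_nbhsl; rewrite invr_gt0 ltr0n.
Unshelve. all: by end_near.
Qed.

Lemma nondecreasing_continuous_itv01 f :
  (forall n, nondecreasing_continuous `[n.+1%:R^-1, 1] f) ->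
  f n.+1%:R^-1 @[n --> \oo] --> f 0 -> nondecreasing_continuous `[0, 1] f.
Proof.
move=> ncf f0; have homof := nondecreasing_itv01 (fun n => (ncf n).2) f0.
by split=> //; exact: within_continuous_itv01 (fun n => (ncf n).1) homof f0.
Qed.

End NondecreasingContinuous.

(** * Uniform convergence *)

Section GeometricDistance.
Variables (R : realType) (V : completeNormedModType R).
Variables (u : nat -> V) (a z : R).
Hypotheses (z01 : 0 <= z < 1).
Hypothesis dist_u : forall n, `|u n.+1 - u n| <= a * z ^+ n.

Let z0 : 0 <= z. Proof. by case/andP: z01. Qed.
Let z1 : z < 1. Proof. by case/andP: z01. Qed.

Lemma is_cvg_geometric_dist : cvgn u.
Proof.
have : cvgn (series (telescope u)).
  apply/normed_cvg/(@series_le_cvg _ _ (geometric a z)) => [n|n||] //=.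
  - exact: le_trans (dist_u n).
  - by apply: is_cvg_geometric_series; rewrite ger0_norm.
move=> /(is_cvgD (is_cvg_cst (u 0%N))); rewrite (_ : _ + _ = u) //.
by apply/funext => n; exact/esym/eq_sum_telescope.
Qed.

Lemma dist_geometric n k :
  `|u (n + k)%N - u n| <= a / (1 - z) * z ^+ n * (1 - z ^+ k).
Proof.
elim: k => [|k IH]; first by rewrite addn0 !subrr normr0 mulr0.
rewrite addnS -[_ - u n](subrKA (u (n + k)%N)).
apply: le_trans (ler_normD _ _) (le_trans (lerD (dist_u _) IH) _).
rewrite exprD exprS le_eqVlt; apply/predU1P; left; field.
by rewrite subr_eq0 gt_eqF.
Qed.

Lemma dist_lim_geometric n : `|limn u - u n| <= a / (1 - z) * z ^+ n.
Proof.
have : `|u m - u n| @[m --> \oo] --> `|limn u - u n|.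
  apply: cvg_norm; apply: cvgB; last exact: cvg_cst.
  exact: is_cvg_geometric_dist.
move/cvgr_to_le; apply; exists n => // m /= /subnKC<-.
apply: le_trans (dist_geometric n _) _; rewrite ler_piMr //; last first.
  by rewrite lerBlDr lerDl exprn_ge0.
by rewrite mulrAC divr_ge0 ?(le_trans _ (dist_u n)) // subr_ge0 ltW.
Qed.

End GeometricDistance.

Lemma uniform_cvg_geometric {T : choiceType} {R : realType}
    {V : completeNormedModType R} (A : set T) (u : nat -> T -> V) (a z : R) :
  0 <= z < 1 ->
  (forall n x, A x -> `|u n.+1 x - u n x| <= a * z ^+ n) ->
  {uniform A, u @ \oo --> (fun x => limn (u ^~ x))}.
Proof.
move=> z01 du P /uniform_nbhs[E []].
rewrite -entourage_ballE => -[e /= e0 eE] EP.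
have : a / (1 - z) * z ^+ n @[n --> \oo] --> 0.
  by case/andP: z01 => z0 z1; apply: cvg_geometric; rewrite ger0_norm.
move/cvgrPdist_lt/(_ e e0); apply: filterS => n /=; rewrite sub0r normrN => ne.
apply: EP => x Ax; apply: eE; rewrite -ball_normE /=.
have := dist_lim_geometric z01 (fun n => du n x Ax) n.
by move=> /le_lt_trans; apply; exact: le_lt_trans (ler_norm _) ne.
Qed.

Lemma uniform_cvg_at {T : choiceType} {U : uniformType} (A : set T)
    (F : set_system (T -> U)) (f : T -> U) x : Filter F -> A x ->
  {uniform A, F --> f} -> g x @[g --> F] --> f x.
Proof.
move=> FF Ax; rewrite -uniform_set1.
by apply: uniform_subset_cvg => y ->.
Qed.

(** * Admissible functions *)

Record admissible {R : realType} (f : R -> R) : Prop := Admissible {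
  admissible_nondecreasing_continuous : nondecreasing_continuous `[0, 1] f;
  admissible0 : f 0 = 0;
  admissible_half : f (1 / 2) = 1 / 16;
  admissible1 : f 1 = 3 / 8 }.

Section AdmissibleStep.
Variables (R : realType) (f : R -> R).
Hypothesis admf : admissible f.
Implicit Types (x y : R) (n : nat).

Lemma admissible_le : {in `[0, 1] &, {homo f : x y / x <= y}}.
Proof. exact: (admissible_nondecreasing_continuous admf).2. Qed.

Lemma admissible_bounds x : x \in `[0, 1] -> 0 <= f x <= 3 / 8.
Proof.
move=> x01; have /andP[x0 x1] := x01.
by rewrite -(admissible0 admf) -(admissible1 admf) !admissible_le ?bound_itvE.
Qed.

(* At the endpoint 1/(n+1) the formula of the next piece takes over; the values
   of an admissible function at 0, 1/2 and 1 make the two agree. *)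
Lemma interrobang_step_small_closed n x : (1 < n)%N -> x \in recip_itv n ->
  interrobang_step f x = 4 ^- n * (1 - 2 * f (x^-1 - n%:R)).
Proof.
move=> n1; rewrite in_itv /= le_eqVlt.
move=> /andP[/predU1P[<- _|nx xn]]; last first.
  by rewrite (interrobang_step_small _ n1) // in_itv /= nx.
rewrite (@interrobang_step_small _ _ n.+1) ?(leqW n1) //; last first.
  by rewrite in_itv /= lexx ltf_pV2 ?posrE ?ltr0n // ltr_nat ltnSn.
rewrite invrK subrr -[n.+1%:R]natr1 addrAC subrr add0r.
by rewrite (admissible0 admf) (admissible1 admf) exprSr invfM; field.
Qed.

Lemma interrobang_step_large_closed x : x \in recip_itv 1 ->
  interrobang_step f x = 3 / 8 - 3 / 4 * f (x^-1 - 1) - 1 / 2 * f (1 - x).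
Proof.
rewrite in_itv /= le_eqVlt => /andP[/predU1P[<- _|xh _]]; last first.
  by rewrite interrobang_step_large // div1r.
rewrite (@interrobang_step_small _ _ 2) //; last first.
  by rewrite in_itv /= lexx ltf_pV2 ?posrE ?ltr0n // ltr_nat.
rewrite invrK subrr (_ : 1 - 2%:R^-1 = 1 / 2); last by field.
rewrite (_ : 2 - 1 = 1) ?(admissible0 admf) ?(admissible1 admf); last by ring.
by rewrite (admissible_half admf); field.
Qed.

Lemma interrobang_step_recip n : (1 < n)%N ->
  interrobang_step f n%:R^-1 = 4 ^- n.
Proof.
move=> n1; rewrite (interrobang_step_small_closed n1).
  by rewrite invrK subrr (admissible0 admf) mulr0 subr0 mulr1.
rewrite in_itv /= lexx andbT lef_pV2 ?posrE ?ltr0n ?ler_nat //.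
exact: ltnW.
Qed.

Lemma admissible_recip_le n x y : (0 < n)%N ->
  x \in recip_itv n -> y \in recip_itv n -> x <= y ->
  f (y^-1 - n%:R) <= f (x^-1 - n%:R).
Proof.
move=> n0 xn yn xy.
by rewrite admissible_le ?recip_itv_invB // recip_itv_invB_le.
Qed.

Lemma interrobang_step_increment n x y : (0 < n)%N ->
  x \in recip_itv n -> y \in recip_itv n -> x <= y ->
  2 * 4 ^- n * (f (x^-1 - n%:R) - f (y^-1 - n%:R))
    <= interrobang_step f y - interrobang_step f x.
Proof.
move=> n0 xn yn xy; have [n1|n1|n1] := ltngtP n 1%N; first by lia.
  by rewrite !(@interrobang_step_small_closed n) //; lra.
move: n0 xn yn; rewrite n1 => n0 xn yn.
rewrite !interrobang_step_large_closed //.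
have x0 := recip_itv_gt0 xn; have y0 := recip_itv_gt0 yn.
have x1 := recip_itv_le1 n0 xn; have y1 := recip_itv_le1 n0 yn.
have := admissible_recip_le n0 xn yn xy.
have : f (1 - y) <= f (1 - x).
  by rewrite admissible_le ?in_itv /=; lra.
by rewrite expr1; lra.
Qed.

Lemma interrobang_step_within_continuous n : (0 < n)%N ->
  {within [set` recip_itv n], continuous (interrobang_step f)}.
Proof.
move=> n0; have [cf _] := admissible_nondecreasing_continuous admf.
have cinv := within_continuous_recip_itv n0 cf.
have [n1|n1|n1] := ltngtP n 1%N; first by lia.
  apply: (@subspace_eq_continuous _ _ _
    (fun x => 4 ^- n * (1 - 2 * f (x^-1 - n%:R)))) => [x /set_mem /= xn|x].
    exact/esym/interrobang_step_small_closed.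
  apply: cvgM; first exact: cvg_cst.
  apply: cvgB; first exact: cvg_cst.
  by apply: cvgM; [exact: cvg_cst|exact: cinv].
move: n0 cinv; rewrite n1 => n0 cinv.
apply: (@subspace_eq_continuous _ _ _ (fun x =>
    3 / 8 - 3 / 4 * f (x^-1 - 1) - 1 / 2 * f (1 - x))) => [x /set_mem /= xn|x].
  exact/esym/interrobang_step_large_closed.
have sub01 : [set` recip_itv 1] `<=` `[0, 1 : R].
  by move=> y; exact: recip_itv_itv01.
have conem := continuous_subspaceW sub01 (within_continuous_onem cf).
apply: cvgB; last by apply: cvgM; [exact: cvg_cst|exact: conem].
apply: cvgB; first exact: cvg_cst.
by apply: cvgM; [exact: cvg_cst|exact: cinv].
Qed.

Lemma interrobang_step_recip_itv n : (0 < n)%N ->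
  nondecreasing_continuous (recip_itv n) (interrobang_step f).
Proof.
move=> n0; split; first exact: interrobang_step_within_continuous.
move=> x y xn yn xy; rewrite -subr_ge0.
apply: le_trans (interrobang_step_increment n0 xn yn xy).
rewrite mulr_ge0 ?mulr_ge0 ?invr_ge0 ?exprn_ge0 // subr_ge0.
exact: admissible_recip_le.
Qed.

Lemma interrobang_step_tail n :
  nondecreasing_continuous `[n.+1%:R^-1, 1] (interrobang_step f).
Proof.
elim: n => [|n IH].
  apply: nondecreasing_continuousS (interrobang_step_recip_itv (ltn0Sn 0)).
  by move=> x; rewrite !in_itv /= invr1 => /andP[x1 ->]; lra.
apply: nondecreasing_continuous_cat (interrobang_step_recip_itv (ltn0Sn n)) IH.
by rewrite lef_pV2 ?posrE ?ltr0n // ler_nat leqnSn invf_le1 ?ltr0n // ler1n.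
Qed.

Lemma admissible_step : admissible (interrobang_step f).
Proof.
split; [|exact: interrobang_step0| |].
- apply: nondecreasing_continuous_itv01 interrobang_step_tail _.
  rewrite interrobang_step0 -cvg_shiftS.
  under eq_fun do rewrite interrobang_step_recip // -exprVn.
  have : (4^-1 : R) ^+ n @[n --> \oo] --> 0.
    by apply: cvg_expr; rewrite ger0_norm; lra.
  by rewrite -cvg_shiftS -cvg_shiftS.
- by rewrite div1r (@interrobang_step_recip 2) //; field.
- rewrite interrobang_step_large_closed; last by rewrite in_itv /= invr1; lra.
  by rewrite invr1 subrr (admissible0 admf); lra.
Qed.

End AdmissibleStep.

(** * The fixed point *)

Lemma admissible_lim {R : realType} (u : nat -> R -> R) (f : R -> R) :
  (forall n, admissible (u n)) -> {uniform `[0, 1], u @ \oo --> f} ->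
  admissible f.
Proof.
move=> admu uf.
have cvg_at x : x \in `[0, 1] -> u n x @[n --> \oo] --> f x.
  by move=> x01; exact: uniform_cvg_at uf.
have lim_eq x c : x \in `[0, 1] -> (forall n, u n x = c) -> f x = c.
  move=> /cvg_at ux uc; move: ux; under eq_fun do rewrite uc.
  by move=> /cvg_lim <- //; rewrite lim_cst.
split; [split| | |].
- apply: uniform_limit_continuous_subspace uf.
  exists 0%N => // n _.
  exact: (admissible_nondecreasing_continuous (admu n)).1.
- move=> x y x01 y01 xy; apply: ler_cvg_to (cvg_at x x01) (cvg_at y y01) _.
  by apply: nearW => n; exact: admissible_le.
- by apply: lim_eq => [|n]; [rewrite in_itv /=; lra|exact: admissible0].
- by apply: lim_eq => [|n]; [rewrite in_itv /=; lra|exact: admissible_half].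
- by apply: lim_eq => [|n]; [rewrite in_itv /=; lra|exact: admissible1].
Qed.

Lemma interrobang_step_cvg {R : realType} (u : nat -> R -> R) (f : R -> R) :
  {in `[0, 1], forall x, u n x @[n --> \oo] --> f x} ->
  {in `[0, 1], forall x,
    interrobang_step (u n) x @[n --> \oo] --> interrobang_step f x}.
Proof.
move=> uf x; rewrite in_itv /= => /andP[x0 x1]; rewrite /interrobang_step.
have [_|xn0] := eqVneq x 0; first exact: cvg_cst.
have {x0 xn0}x0 : 0 < x by rewrite lt0r xn0.
have cvgMl y c : y \in `[0, 1] -> c * u n y @[n --> \oo] --> c * f y.
  by move=> y01; apply: cvgM; [exact: cvg_cst|exact: uf].
case: (leP x (1 / 2)) => xh.
  apply: cvgM; first exact: cvg_cst.
  by apply: cvgB; [exact: cvg_cst|exact/cvgMl/subset_itv_co_cc/fracpart_itv].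
apply: cvgB; last by apply: cvgMl; rewrite in_itv /=; lra.
apply: cvgB; [exact: cvg_cst|apply: cvgMl].
by apply: (@recip_itv_invB _ 1) => //; rewrite in_itv /= invr1; lra.
Qed.

Lemma expV4_gt0 (K : realFieldType) n : 0 < 4 ^- n :> K.
Proof. by rewrite invr_gt0 exprn_gt0. Qed.

Lemma expV4_le16 (K : realFieldType) n : (1 < n)%N -> 4 ^- n <= 1 / 16 :> K.
Proof.
move=> n1; rewrite (_ : 1 / 16 = 4 ^- 2); last by field.
by rewrite lef_pV2 ?posrE ?exprn_gt0 // ler_eXn2l //; lra.
Qed.

(* The coefficients of the second formula add up to 3/4 + 1/2 > 1, but 1 - x
   lies in [0, 1/2], where the weight is 1/3: 3/4 + 1/2 * 1/3 = 11/12. *)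
Definition interrobang_weight {R : realFieldType} (x : R) : R :=
  if x <= 1 / 2 then 1 / 3 else 1.

Lemma interrobang_step_contraction {K : archiRealFieldType} (e : K)
    (f g : K -> K) :
  {in `[0, 1], forall x, `|f x - g x| <= e * interrobang_weight x} ->
  {in `[0, 1], forall x, `|interrobang_step f x - interrobang_step g x|
    <= 11 / 12 * e * interrobang_weight x}.
Proof.
move=> fg x; have e0 : 0 <= e.
  have := fg 0; rewrite in_itv /= lexx ler01.
  move=> /(_ isT)/(le_trans (normr_ge0 _)).
  by rewrite /interrobang_weight ifT; lra.
have fg1 y : y \in `[0, 1] -> `|f y - g y| <= e.
  move=> y01; apply: le_trans (fg y y01) _.
  by rewrite /interrobang_weight; case: ifP; lra.
rewrite in_itv /= => /andP[]; rewrite le_eqVlt => /predU1P[<- _|x0 x1].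
  rewrite !interrobang_step0 subrr normr0 /interrobang_weight.
  by case: ifP; lra.
rewrite /interrobang_weight; case: (leP x (1 / 2)) => xh.
  have [|n n1 xn] := @ex_recip_itvoc_small K x; first by rewrite x0.
  rewrite !(interrobang_step_small _ n1 xn).
  have := fg1 _ (recip_itv_invB (ltnW n1) (subset_itv_oc_cc xn)).
  have := expV4_gt0 K n; have := expV4_le16 K n1.
  by rewrite !ler_norml => *; nra.
rewrite !interrobang_step_large //.
have xI : x \in recip_itv 1 by rewrite in_itv /= invr1; lra.
have := fg1 _ (recip_itv_invB (ltn0Sn 0) xI).
have /fg : 1 - x \in `[0, 1] by rewrite in_itv /=; lra.
rewrite /interrobang_weight ifT; last by lra.
by rewrite !ler_norml; lra.
Qed.

(* Chosen for its values 0, 1/16 and 3/8 at 0, 1/2 and 1. *)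
Definition interrobang_seed {R : realType} (x : R) : R :=
  x ^+ 2 / 8 + x ^+ 3 / 4.

Lemma admissible_seed {R : realType} : admissible (@interrobang_seed R).
Proof.
split; rewrite /interrobang_seed; [split|by lra|by lra|by lra].
  apply: continuous_subspaceT => x.
  by apply: cvgD; apply: cvgM; [exact: exprn_continuous|exact: cvg_cst|
    exact: exprn_continuous|exact: cvg_cst].
move=> x y; rewrite !in_itv /= => /andP[x0 x1] /andP[y0 y1] xy.
by rewrite lerD // ler_pM2r ?invr_gt0 // lerXn2r.
Qed.

Section Interrobang.
Variable R : realType.
Implicit Types (x y : R) (n : nat).

Definition interrobang_iter n : R -> R :=
  iter n interrobang_step interrobang_seed.

Definition interrobang x : R := limn (interrobang_iter ^~ x).

Lemma admissible_iter n : admissible (interrobang_iter n).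
Proof.
by elim: n => [|n IH]; [exact: admissible_seed | exact: admissible_step].
Qed.

Lemma interrobang_iter_dist n : {in `[0, 1], forall x,
  `|interrobang_iter n.+1 x - interrobang_iter n x|
    <= (11 / 12) ^+ n * 2 * interrobang_weight x}.
Proof.
elim: n => [|n IH]; last first.
  by rewrite exprS -!mulrA mulrA; exact: interrobang_step_contraction.
move=> x x01; have := admissible_bounds (admissible_iter 0) x01.
have := admissible_bounds (admissible_iter 1) x01.
rewrite expr0 mul1r ler_norml /interrobang_weight => *.
by case: ifP => _; lra.
Qed.

Lemma interrobang_uniform_cvg :
  {uniform `[0, 1], interrobang_iter @ \oo --> interrobang}.
Proof.
apply: (@uniform_cvg_geometric _ R R _ _ 2 (11 / 12)) => [|n x x01].
  by lra.
apply: le_trans (interrobang_iter_dist n x01) _.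
have : 0 <= (11 / 12 : R) ^+ n by rewrite exprn_ge0 //; lra.
by rewrite /interrobang_weight; case: ifP => _; lra.
Qed.

Lemma interrobang_cvg x : x \in `[0, 1] ->
  interrobang_iter n x @[n --> \oo] --> interrobang x.
Proof. by move=> x01; exact: uniform_cvg_at interrobang_uniform_cvg. Qed.

Lemma interrobang_fixpoint :
  {in `[0, 1], interrobang_step interrobang =1 interrobang}.
Proof.
move=> x x01; have := interrobang_cvg x01; rewrite -cvg_shiftS /=.
by apply: cvg_unique => //; exact: interrobang_step_cvg interrobang_cvg x x01.
Qed.

Lemma admissible_interrobang : admissible interrobang.
Proof. exact: admissible_lim admissible_iter interrobang_uniform_cvg. Qed.

End Interrobang.

(** * Fractions *)

(* Fractions need not be in lowest terms: the bound on a + b decreases along the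
   recursion all the same. *)
Definition height_le {K : realFieldType} (m : nat) (x : K) : Prop :=
  exists a b, [/\ (a <= b)%N, (0 < b)%N, (a + b <= m)%N & x = a%:R / b%:R].

Lemma height_le_qheight (q : rat) : 0 <= q <= 1 -> height_le (qheight q) q.
Proof.
move=> /andP[q0 q1].
have qE : q = `|numq q|%N%:R / `|denq q|%N%:R.
  rewrite !natr_absz ger0_norm ?numq_ge0 // ger0_norm ?denq_ge0 //.
  by rewrite divq_num_den.
have d0 : (0 < `|denq q|)%N by rewrite absz_gt0 denq_neq0.
exists `|numq q|%N, `|denq q|%N; split => //.
by move: q1; rewrite {1}qE ler_pdivrMr ?ltr0n // mul1r ler_nat.
Qed.

Lemma height_le_ratr (R : realFieldType) m (q : rat) :
  height_le m q -> height_le m (ratr q : R).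
Proof.
move=> [a [b [ab b0 abm ->]]]; exists a, b; split => //.
by rewrite fmorph_div !rmorph_nat.
Qed.

Section Height.
Variable K : realFieldType.
Implicit Types (x : K) (m n : nat).

Lemma not_height_le0 x : ~ height_le 0 x.
Proof. by move=> [a [b [_ + + _]]]; lia. Qed.

Lemma height_le_itv01 m x : height_le m x -> x \in `[0, 1].
Proof.
move=> [a [b [ab b0 _ ->]]].
by rewrite in_itv /= divr_ge0 //= ler_pdivrMr ?ltr0n // mul1r ler_nat.
Qed.

Lemma height_le_recip m n x : (0 < n)%N -> x \in recip_itv n ->
  height_le m.+1 x -> height_le m (x^-1 - n%:R).
Proof.
move=> n0 xn [a [b [ab b0 abm xE]]].
have x0 := recip_itv_gt0 xn.
have a0 : (0 < a)%N.
  by move: x0; rewrite xE pmulr_lgt0 ?invr_gt0 ?ltr0n.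
have := recip_itv_invB n0 xn.
rewrite xE invf_div in_itv /= subr_ge0 lerBlDl natr1.
rewrite ler_pdivlMr ?ltr0n // ler_pdivrMr ?ltr0n // -!natrM !ler_nat mulSn.
move=> /andP[nb bn].
exists (b - n * a)%N, a; split; [lia|by []|nia|].
by rewrite natrB // natrM mulrBl mulfK // pnatr_eq0 -lt0n.
Qed.

Lemma height_le_onem m x : 1 / 2 < x ->
  height_le m.+1 x -> height_le m (1 - x).
Proof.
move=> xh [a [b [ab b0 abm xE]]]; move: xh.
rewrite xE ltr_pdivlMr ?ltr0n // mulrAC ltr_pdivrMr // mul1r -natrM ltr_nat.
move=> ba.
exists (b - a)%N, b; split; [lia|by []|lia|].
by rewrite natrB // mulrBl divff // pnatr_eq0 -lt0n.
Qed.

End Height.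

(** * The limit is the extension *)

Section InterrobangValues.
Variable R : realType.
Implicit Types (x y u v : R).

Lemma interrobang0 : interrobang (0 : R) = 0.
Proof. exact: admissible0 (admissible_interrobang R). Qed.

Lemma interrobang_le : {in `[0, 1] &, {homo @interrobang R : x y / x <= y}}.
Proof. exact: admissible_le (admissible_interrobang R). Qed.

Lemma Iq_fuelS m (q : rat) : Iq_fuel m.+1 q = interrobang_step (Iq_fuel m) q.
Proof. by []. Qed.

Lemma interrobang_Iq_fuel m (q : rat) : height_le m q ->
  interrobang (ratr q : R) = ratr (Iq_fuel m q).
Proof.
elim: m q => [|m IH] q hq; first by have := not_height_le0 hq.
rewrite Iq_fuelS -interrobang_fixpoint; last first.
  exact: height_le_itv01 (height_le_ratr R hq).
move: (height_le_itv01 hq); rewrite in_itv /= => /andP[].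
rewrite le_eqVlt => /predU1P[<- _|q0 q1].
  by rewrite interrobang_step0 !rmorph0 interrobang_step0.
have [qh|qh] := leP q (1 / 2).
  have [|n n1 qn] := @ex_recip_itvoc_small _ q; first by rewrite q0.
  have rqn : (ratr q : R) \in `]n.+1%:R^-1, n%:R^-1].
    move: qn; rewrite !in_itv /= -(ltr_rat R) -(ler_rat R) !fmorphV.
    by rewrite !rmorph_nat.
  rewrite !(interrobang_step_small _ n1) //.
  rewrite -fmorphV -(rmorph_nat (@ratr R) n) -rmorphB IH; last first.
    by apply: height_le_recip hq; [exact: ltnW|exact: subset_itv_oc_cc].
  by rewrite rmorphM rmorphB rmorph1 rmorphM fmorphV rmorphXn !rmorph_nat.
have rqh : 1 / 2 < ratr q :> R.
  by move: qh; rewrite -(ltr_rat R) fmorph_div !rmorph1 rmorph_nat.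
rewrite !interrobang_step_large //.
rewrite -(rmorph1 (@ratr R)) -fmorphV -!rmorphB !IH.
- by rewrite !(rmorphB, rmorphM, fmorphV, rmorph1, rmorph_nat).
- exact: height_le_onem.
- by apply: (@height_le_recip _ _ 1); rewrite // in_itv /= invr1; lra.
Qed.

Lemma interrobang_ratr (q : rat) : 0 <= q <= 1 ->
  interrobang (ratr q : R) = ratr (interrobangQ q).
Proof. by move=> /height_le_qheight /interrobang_Iq_fuel. Qed.

Lemma interrobang_gt0 x : 0 < x <= 1 -> 0 < interrobang x.
Proof.
move=> /andP[x0 x1]; have [n nx] := ex_natSinv_lt x0.
have {}nx : n.+2%:R^-1 <= x.
  by apply: le_trans (ltW nx); rewrite lef_pV2 ?posrE ?ltr0n // ler_nat.
have n01 : n.+2%:R^-1 \in `[0, 1 : R].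
  by rewrite in_itv /= invr_ge0 ler0n (le_trans nx).
apply: (@lt_le_trans _ _ (interrobang n.+2%:R^-1)).
  rewrite -interrobang_fixpoint // interrobang_step_recip //.
  exact: admissible_interrobang.
by apply: interrobang_le; rewrite // in_itv /= ltW.
Qed.

Lemma interrobang_increment n x y : (0 < n)%N ->
  x \in recip_itv n -> y \in recip_itv n -> x <= y ->
  2 * 4 ^- n * (interrobang (x^-1 - n%:R) - interrobang (y^-1 - n%:R))
    <= interrobang y - interrobang x.
Proof.
move=> n0 xn yn xy; rewrite -(interrobang_fixpoint (recip_itv_itv01 n0 xn)).
rewrite -(interrobang_fixpoint (recip_itv_itv01 n0 yn)).
exact: interrobang_step_increment (admissible_interrobang R) _ _ _ n0 xn yn xy.
Qed.

Lemma interrobang_lt_height m x u v : height_le m x ->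
  0 <= u -> u <= x -> x <= v -> v <= 1 -> u < v ->
  interrobang u < interrobang v.
Proof.
elim: m x u v => [|m IH] x u v hx u0 ux xv v1 uv.
  by have := not_height_le0 hx.
have [x0|x0] := leP x 0.
  have -> : u = 0 by lra.
  by rewrite interrobang0 interrobang_gt0; lra.
have [n [u' [v' [n0 [u'n xn v'n] /andP[uu' u'x] /andP[xv' v'v] uv']]]] :=
  ex_recip_itv_subitv x0 ux xv v1 uv.
have : interrobang (v'^-1 - n%:R) < interrobang (u'^-1 - n%:R).
  move: (recip_itv_invB n0 u'n) (recip_itv_invB n0 v'n).
  rewrite !in_itv /= => /andP[_ u'1] /andP[v'0 _].
  apply: (IH (x^-1 - n%:R)); rewrite ?recip_itv_invB_le ?recip_itv_invB_lt //.
  exact: height_le_recip.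
have : interrobang u <= interrobang u'.
  by apply: interrobang_le; rewrite ?in_itv /=; lra.
have : interrobang v' <= interrobang v.
  by apply: interrobang_le; rewrite ?in_itv /=; lra.
have := interrobang_increment n0 u'n v'n (ltW uv').
by have := expV4_gt0 R n; nra.
Qed.

Lemma interrobang_lt x y :
  0 <= x -> x < y -> y <= 1 -> interrobang x < interrobang y.
Proof.
move=> x0 xy y1; have [q] := rat_in_itvoo xy.
rewrite in_itv /= => /andP[xq qy].
have q01 : 0 <= q <= 1.
  by rewrite -(ler0q R) -(ler_rat R q) rmorph1; lra.
apply: (interrobang_lt_height (height_le_ratr R (height_le_qheight q01))); lra.
Qed.

End InterrobangValues.

Theorem mainTheorem13 (R : realType) :
  exists F : R -> R,
    [/\ {within `[0, 1], continuous F},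
        (forall x y : R, 0 <= x -> x < y -> y <= 1 -> F x < F y),
        (forall q : rat, 0 <= q <= 1 -> F (ratr q) = ratr (interrobangQ q)),
        (forall G : R -> R,
           {within `[0, 1], continuous G} ->
           (forall x y : R, 0 <= x -> x < y -> y <= 1 -> G x < G y) ->
           (forall q : rat, 0 <= q <= 1 -> G (ratr q) = ratr (interrobangQ q)) ->
           forall x : R, 0 <= x <= 1 -> G x = F x)
      & [/\ F 0 = 0,
            (forall x : R, 0 < x <= 1 / 2 ->
               F x = (4 : R) ^ (- Num.floor x^-1) * (1 - 2 * F (fracpart x^-1))) &
            (forall x : R, 1 / 2 < x <= 1 ->
               F x = 3 / 8 - 3 / 4 * F (x^-1 - 1) - 1 / 2 * F (1 - x))]].
Proof.
have [[F_cont _] _ _ _] := admissible_interrobang R.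
exists (@interrobang R); split => //.
- exact: interrobang_lt.
- exact: interrobang_ratr.
- move=> G G_cont _ G_rat x x01.
  apply: (eq_continuous_rat ltr01 G_cont F_cont) => // q.
  rewrite in_itv /= ler0q -[1](rmorph1 (@ratr R)) ler_rat => q01.
  by rewrite G_rat // interrobang_ratr.
- split=> [|x /andP[x0 xh]|x /andP[xh x1]]; first exact: interrobang0.
    rewrite -interrobang_fixpoint; last by rewrite in_itv /=; lra.
    by rewrite {1}/interrobang_step gt_eqF // xh.
  by rewrite -interrobang_fixpoint ?interrobang_step_large // in_itv /=; lra.
Qed.
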